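(* Let $\mathcal{O}\subset\mathbb{R}^4$ be open with coordinates $(u_1,u_2,u_3,u_4)$, and let $a,b\in C^\infty(\mathcal{O})$ depend only on $(u_1,u_2)$. Consider the Walker metric $g$ on $\mathcal{O}$ whose matrix in the coordinate frame is $$(g_{ij})=\begin{pmatrix}0&0&1&0\\0&0&0&1\\1&0&a&0\\0&1&0&b\end{pmatrix}.$$ Then $g$ is Einstein if and only if $$a(u_1,u_2)=Ku_1^2+Au_1+B(u_2),\qquad b(u_1,u_2)=Ku_2^2+Cu_2+D(u_1),$$ where $K,A,C$ are constants and $B$ (a function of $u_2$) and $D$ (a function of $u_1$) are smooth functions satisfying \begin{align*} B_2D_1&=0,\\ \big(D_1(u_1^2K+u_1A+B)\big)_1&=0,\\ \big(B_2(u_2^2K+u_2C+D)\big)_2&=0. \end{align*}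
   Context: For a function $h$, $h_i=\partial h/\partial u_i$ and $(\cdot)_i$ denotes the partial derivative with respect to $u_i$. The metric is said to be Einstein if its Ricci tensor $\rho$ satisfies $\rho=\lambda g$ for a constant $\lambda$.
   Formalization: The open set O is assumed connected (otherwise A and C may differ between components), and ''depends only on (u_1,u_2)'', ''function of u_2'', ''function of u_1'' mean that the other partial derivatives vanish on O. *)

(* Defs.v *)
From HB Require Import structures.
From mathcomp Require Import all_boot all_order all_algebra.
From mathcomp Require Import all_classical all_reals all_analysis.
Set Implicit Arguments. Unset Strict Implicit. Unset Printing Implicit Defensive.
Import Order.TTheory GRing.Theory Num.Theory.
Import numFieldNormedType.Exports.
Local Open Scope classical_set_scope.
Local Open Scope ring_scope.

(* Points of R^4 are row vectors; coordinate u_{i+1} is  ucoord u i. *)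
Definition pt (R : realType) := 'rV[R]_4.
Definition ucoord {R : realType} (u : pt R) (i : 'I_4) : R := u ord0 i.
Definition ax {R : realType} (i : 'I_4) : pt R := delta_mx ord0 i.

Definition partial {R : realType} (i : 'I_4) (f : pt R -> R) : pt R -> R :=
  fun u => 'D_(ax i) f u.

Fixpoint iter_partial {R : realType} (l : seq 'I_4) (f : pt R -> R) : pt R -> R :=
  match l with
  | [::] => f
  | i :: l' => partial i (iter_partial l' f)
  end.

Definition smooth_on {R : realType} (O : set (pt R)) (f : pt R -> R) : Prop :=
  forall (l : seq 'I_4) (u : pt R), O u ->
    {for u, continuous (iter_partial l f)} /\
    forall i : 'I_4, derivable (iter_partial l f) u (ax i).

Definition christoffel {R : realType} (g : pt R -> 'M[R]_4)
  (k i j : 'I_4) (u : pt R) : R :=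
  2^-1 * \sum_(l < 4) (invmx (g u)) k l *
     (partial i (fun v => g v j l) u + partial j (fun v => g v i l) u
      - partial l (fun v => g v i j) u).

(* Ricci tensor rho_{ij} = R^k_{kij} *)
Definition ricci {R : realType} (g : pt R -> 'M[R]_4) (i j : 'I_4) (u : pt R) : R :=
  \sum_(k < 4) (partial k (christoffel g k i j) u
                - partial j (christoffel g k i k) u)
  + \sum_(k < 4) \sum_(l < 4)
      (christoffel g k k l u * christoffel g l i j u
       - christoffel g k j l u * christoffel g l i k u).

Definition einstein_on {R : realType} (O : set (pt R)) (g : pt R -> 'M[R]_4) : Prop :=
  exists lambda : R, forall u, O u -> forall i j : 'I_4,
    ricci g i j u = lambda * g u i j.

Definition walker {R : realType} (a b : pt R -> R) : pt R -> 'M[R]_4 :=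
  fun u => \matrix_(i < 4, j < 4)
    (if (val i == 0%N) && (val j == 2%N) then 1
     else if (val i == 2%N) && (val j == 0%N) then 1
     else if (val i == 1%N) && (val j == 3%N) then 1
     else if (val i == 3%N) && (val j == 1%N) then 1
     else if (val i == 2%N) && (val j == 2%N) then a u
     else if (val i == 3%N) && (val j == 3%N) then b u
     else 0).

Definition depends_only_on {R : realType} (O : set (pt R)) (S : seq 'I_4)
  (f : pt R -> R) : Prop :=
  forall u, O u -> forall i : 'I_4, i \notin S -> partial i f u = 0.

Definition i0 : 'I_4 := @Ordinal 4 0 isT.
Definition i1 : 'I_4 := @Ordinal 4 1 isT.

(* Main.v *)
Require Import Defs.
From HB Require Import structures.
From mathcomp Require Import all_boot all_order all_algebra.
From mathcomp Require Import all_classical all_reals all_analysis.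
From mathcomp Require Import ring lra.
Import Order.TTheory GRing.Theory Num.Theory.
Import numFieldNormedType.Exports.
Local Open Scope classical_set_scope.
Local Open Scope ring_scope.

(* Write f_i for the partial derivatives.  The Ricci tensor of the metric has
   components rho_13 = a_11/2, rho_24 = b_22/2, rho_23 = a_12/2,
   rho_14 = b_12/2, rho_34 = - a_2 b_1/2, rho_33 = (a a_11 + (b a_2)_2)/2,
   rho_44 = (b b_22 + (a b_1)_1)/2, the others being 0.  Hence the Einstein
   equation with constant K says a_11 = b_22 = 2K, a_12 = b_12 = 0,
   a_2 b_1 = 0 and (b a_2)_2 = (a b_1)_1 = 0.  By the first equations
   a_1 - 2K u_1 and b_2 - 2K u_2 have zero gradient, so they are constants A, C
   on the connected set O; then B := a - K u_1^2 - A u_1 and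
   D := b - K u_2^2 - C u_2 satisfy B_2 = a_2 and D_1 = b_1. *)

(** * Mean value theorem along a line in a normed space *)

Lemma is_derive_line (R : realType) (V W : normedModType R) (f : V -> W)
    (u v : V) (t : R) :
  derivable f (t *: v + u) v ->
  is_derive t (1 : R) (fun s : R => f (s *: v + u)) ('D_v f (t *: v + u)).
Proof.
(* Both difference quotients are the same function of h, since [(h + t) *: v + u] is
   [h *: v + (t *: v + u)]. *)
have E : (fun h : R => h^-1 *: (((fun s : R => f (s *: v + u)) \o shift t)
            (h *: (1 : R)) - f (t *: v + u))) =
    (fun h : R => h^-1 *: ((f \o shift (t *: v + u)) (h *: v) -
            f (t *: v + u))).
  by apply/funext => h /=; rewrite [h *: 1]mulr1 scalerDl addrA.
by move=> df; apply: DeriveDef; rewrite /derivable /derive ?E.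
Qed.

Lemma MVT_line (R : realType) (V : normedModType R) (f : V -> R)
    (u v : V) (h : R) :
  0 < h -> (forall t, 0 <= t <= h -> derivable f (t *: v + u) v) ->
  exists2 c, 0 < c < h & f (h *: v + u) - f u = 'D_v f (c *: v + u) * h.
Proof.
move=> h0 df.
have [x||c] := @MVT R (fun s => f (s *: v + u)) (fun s => 'D_v f (s *: v + u))
  0 h h0.
- rewrite in_itv /= => /andP[x0 xh]; apply: is_derive_line; apply: df.
  by rewrite !ltW.
- apply: derivable_within_continuous => x; rewrite in_itv /= => xh.
  by have [] := @is_derive_line _ _ _ f u v x (df _ xh).
by rewrite in_itv /= scale0r add0r subr0 => ch E; exists c.
Qed.

(** The two bounds on t say that t lies between 0 and h, whatever the sign of h; the mean value
    theorem on that segment then gives equal end values. *)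
Lemma derive0_line_constant (R : realType) (V : normedModType R) (f : V -> R)
    (u v : V) (h : R) :
  (forall t, `|t| <= `|h| -> `|h - t| <= `|h| ->
     derivable f (t *: v + u) v /\ 'D_v f (t *: v + u) = 0) ->
  f (h *: v + u) = f u.
Proof.
move=> df; have [h0|h0|->] := ltgtP h 0; last by rewrite scale0r add0r.
(* For negative h the segment is run backwards, from [h *: v + u] with length [- h]. *)
- have Nh0 : 0 < - h by rewrite oppr_gt0.
  have H t : 0 <= t <= - h ->
      derivable f (t *: v + (h *: v + u)) v /\
      'D_v f (t *: v + (h *: v + u)) = 0.
    move=> /andP[t0 th]; rewrite addrA -scalerDl; apply: df.
      by rewrite !ler0_norm //; lra.
    by rewrite !ler0_norm //; lra.
  have [t th|c /andP[c0 ch]] := @MVT_line _ _ f (h *: v + u) v (- h) Nh0.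
    by have [] := H t th.
  have [|_ ->] := H c; first by rewrite !ltW.
  by rewrite mul0r addrA -scalerDl addNr scale0r add0r => /subr0_eq.
- have H t : 0 <= t <= h ->
      derivable f (t *: v + u) v /\ 'D_v f (t *: v + u) = 0.
    by move=> /andP[t0 th]; apply: df; rewrite !ger0_norm //; lra.
  have [t th|c /andP[c0 ch]] := @MVT_line _ _ f u v h h0.
    by have [] := H t th.
  have [|_ ->] := H c; first by rewrite !ltW.
  by rewrite mul0r => /subr0_eq.
Qed.

(** * Open subsets of R^4: zero gradients and symmetry of mixed partial derivatives *)

Section OpenSet.
Context {R : realType} {O : set (pt R)}.
Hypothesis oO : open O.
Implicit Types (f g : pt R -> R) (u v : pt R) (i j : 'I_4).

(** Balls of row vectors are taken entrywise, so they are coordinate boxes. *)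
Lemma open_box u : O u ->
  exists2 e : R, 0 < e & forall v, (forall i, `|ucoord u i - ucoord v i| < e) -> O v.
Proof.
move=> Ou; have /nbhs_ballP[e /= e0 eO] : nbhs u O by exact: open_nbhs_nbhs.
exists e => // v uv; apply: eO; split => // i j.
by rewrite ord1 -ball_normE /=; exact: uv.
Qed.

Lemma ucoord_line u (t : R) i j :
  ucoord (t *: ax i + u) j = (if j == i then t else 0) + ucoord u j.
Proof.
by rewrite /ucoord /ax !mxE eqxx /=; case: eqP => _; rewrite ?mulr1 ?mulr0.
Qed.

(** A coordinate moves by at most 2 h, attained when i = j; the factor 3 makes the bound strict. *)
Lemma ucoord_square u i j k (h s t : R) : 0 < h ->
  0 <= s <= h -> 0 <= t <= h ->
  `|ucoord u k - ucoord (t *: ax j + (s *: ax i + u)) k| < 3 * h.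
Proof.
move=> h0 /andP[s0 sh] /andP[t0 th]; rewrite !ucoord_line ltr_norml.
move: (ucoord u k) => x.
by case: ifP => _; case: ifP => _; apply/andP; split; lra.
Qed.

Lemma near_open (P : pt R -> Prop) u : O u -> (forall v, O v -> P v) ->
  \forall v \near u, P v.
Proof.
by move=> Ou OP; apply: filterS OP _; exact: open_nbhs_nbhs.
Qed.

(** Closed formulas will hold on O only; as O is open they hold near each of its points, which is
    all a derivative sees. *)
Lemma near_partial i f g u : O u -> (forall v, O v -> f v = g v) ->
  partial i f u = partial i g u.
Proof.
move=> Ou fg; apply: near_eq_derive; exact: near_open.
Qed.

Lemma near_derivable v f g u : O u -> (forall w, O w -> f w = g w) ->
  derivable f u v -> derivable g u v.
Proof.
move=> Ou fg; apply: near_eq_derivable; exact: near_open.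
Qed.

Lemma near_continuous f g u : O u -> (forall w, O w -> f w = g w) ->
  {for u, continuous f} -> {for u, continuous g}.
Proof.
move=> Ou fg; rewrite /prop_for /continuous_at -(fg _ Ou) => cf.
exact: cvg_trans (near_eq_cvg (near_open _ _ Ou fg)) cf.
Qed.

(** A nearby v is reached from u by moves parallel to the axes inside a box contained in O, and f is
    constant along each move. *)
Lemma partial0_locally_constant f u : O u ->
  (forall v i, O v -> derivable f v (ax i) /\ partial i f v = 0) ->
  \forall v \near u, f v = f u.
Proof.
move=> Ou df; have [e e0 eO] := open_box _ Ou.
near=> v.
have uv i : `|ucoord u i - ucoord v i| < e.
  have : ball u e v by near: v; exact: nbhsx_ballx.
  by move=> [_ /(_ ord0 i)]; rewrite -ball_normE.
(* [w k] agrees with [v] in the first [k] coordinates and with [u] in the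
   others: consecutive points differ along a single axis. *)
pose w k : pt R := \row_j (if (j < k)%N then ucoord v j else ucoord u j).
have step k : f (w k.+1) = f (w k).
  (* From k = 4 on, all coordinates are already those of v and the points coincide. *)
  have [k4|k4] := ltnP k 4; last first.
    congr f; apply/rowP => j; rewrite !mxE.
    by rewrite (leq_trans (ltn_ord j) k4) (leq_trans (ltn_ord j) (leqW k4)).
  pose i := Ordinal k4.
  have -> : w k.+1 = (ucoord v i - ucoord u i) *: ax i + w k.
    apply/rowP => j; rewrite [RHS]ucoord_line /ucoord !mxE ltnS leq_eqVlt.
    rewrite -[(j == k :> nat)]/(j == i).
    have [->|_] := eqVneq j i; last by rewrite /= add0r.
    by rewrite /= ltnn subrK.
  apply: derive0_line_constant => t th1 th2; apply: df; apply: eO => j.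
  rewrite ucoord_line /ucoord !mxE.
  have [->|_] := eqVneq j i.
    rewrite /= ltnn -/(ucoord u i) opprD addrCA subrr addr0 normrN.
    by rewrite (le_lt_trans th1) // distrC.
  by case: ifP => _; rewrite add0r ?subrr ?normr0 //; exact: uv.
have -> : v = w 4 by apply/rowP => j; rewrite !mxE ltn_ord.
by rewrite !step; congr f; apply/rowP => j; rewrite !mxE.
Unshelve. all: by end_near. Qed.

(** By local constancy the level set through a point of O and its complement in O are both open, so
    connectedness leaves only the level set. For empty O any constant serves. *)
Lemma partial0_constant f : connected O ->
  (forall v i, O v -> derivable f v (ax i) /\ partial i f v = 0) ->
  exists c, forall u, O u -> f u = c.
Proof.
move=> cO df; have [[u0 Ou0]|nO] := pselect (O !=set0); last first.
  by exists 0 => u Ou; exfalso; apply: nO; exists u.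
exists (f u0).
pose B := O `&` [set u | f u = f u0].
have oB : open B.
  rewrite openE => u [Ou fu]; rewrite /interior.
  apply: filterI; first exact: open_nbhs_nbhs.
  by apply: filterS (partial0_locally_constant _ _ Ou df) => v /= ->.
have oN : open (O `&` [set u | f u <> f u0]).
  rewrite openE => u [Ou fu]; rewrite /interior.
  apply: filterI; first exact: open_nbhs_nbhs.
  by apply: filterS (partial0_locally_constant _ _ Ou df) => v /= ->.
suff BO : B = O by move=> u; rewrite -BO => -[].
apply: cO; first by exists u0.
- by exists B => //; rewrite /B setIA setIid.
(* Connectedness also asks for B as the trace on O of a closed set: the complement of the open set
   where f takes other values. *)
- exists (~` (O `&` [set u | f u <> f u0])); first exact: open_closedC.
  apply/seteqP; split => u [Ou fu]; split => //.
    by move=> [].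
  by apply: contrapT => nfu; apply: fu.
Qed.

(** Two uses of the mean value theorem: in direction i for F, the increment of f under a shift by h
    along axis j, then in direction j for [partial i f]. *)
Lemma second_difference f u i j (h : R) : 0 < h ->
  (forall s t, 0 <= s <= h -> 0 <= t <= h -> O (t *: ax j + (s *: ax i + u))) ->
  (forall v, O v -> derivable f v (ax i)) ->
  (forall v, O v -> derivable (partial i f) v (ax j)) ->
  exists s t, [/\ 0 < s < h, 0 < t < h &
    f (h *: ax j + (h *: ax i + u)) - f (h *: ax i + u)
      - f (h *: ax j + u) + f u =
    partial j (partial i f) (t *: ax j + (s *: ax i + u)) * h * h].
Proof.
move=> h0 hO df ddf.
have hh : 0 <= h <= h by rewrite (ltW h0) lexx.
have h00 : 0 <= (0 : R) <= h by apply/andP; split; [exact: lexx|exact: ltW].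
pose F := (fun v => f (h *: ax j + v)) - f.
have dF v : derivable f (h *: ax j + v) (ax i) -> derivable f v (ax i) ->
    is_derive v (ax i) F (partial i f (h *: ax j + v) - partial i f v).
  move=> df1 df2; apply: is_deriveB; last exact: DeriveDef.
  have E : (fun t : R => t^-1 *: (((fun v => f (h *: ax j + v)) \o shift v)
              (t *: ax i) - f (h *: ax j + v))) =
      (fun t : R => t^-1 *: ((f \o shift (h *: ax j + v)) (t *: ax i) -
              f (h *: ax j + v))).
    by apply/funext => t /=; rewrite addrCA.
  by apply: DeriveDef; rewrite /partial /derivable /derive ?E.
have [t th|s sh] := @MVT_line _ _ F u (ax i) h h0.
  have := hO _ _ th h00; rewrite scale0r add0r => O1.
  by have [] := dF _ (df _ (hO _ _ th hh)) (df _ O1).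
have sh' : 0 <= s <= h by case/andP: sh => ? ?; rewrite !ltW.
have O1 := hO _ _ sh' h00; rewrite scale0r add0r in O1.
have [_ ->] := dF _ (df _ (hO _ _ sh' hh)) (df _ O1).
have [t th|t th ->] := @MVT_line _ _ (partial i f) (s *: ax i + u) (ax j) h h0.
  exact/ddf/hO.
by rewrite /F !fctE => E; exists s, t; split => //; rewrite -E; ring.
Qed.

(* The second difference is symmetric in [i] and [j], so arbitrarily close to
   [u] the two mixed partials take a common value, though maybe not at the same
   point. *)
Lemma partialC f u i j : O u ->
  (forall k v, O v -> derivable f v (ax k)) ->
  (forall k l v, O v -> derivable (partial k f) v (ax l)) ->
  {for u, continuous (partial i (partial j f))} ->
  {for u, continuous (partial j (partial i f))} ->
  partial i (partial j f) u = partial j (partial i f) u.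
Proof.
move=> Ou df ddf cij cji; apply: contrapT => /eqP neq.
(* With d half the distance between the two values, no number is within d of both. *)
have [d d0 dE] : exists2 d : R, 0 < d &
    `|partial i (partial j f) u - partial j (partial i f) u| = d * 2.
  exists (`|partial i (partial j f) u - partial j (partial i f) u| / 2).
    by rewrite divr_gt0 // normr_gt0 subr_eq0.
  by rewrite divfK // pnatr_eq0.
have /nbhs_ballP[e1 /= e10 He1] := cij _ (nbhsx_ballx _ _ d0).
have /nbhs_ballP[e2 /= e20 He2] := cji _ (nbhsx_ballx _ _ d0).
have [e3 e30 eO] := open_box _ Ou.
(* The square of side h must fit into both continuity balls and into O; 3 h is the bound of
   [ucoord_square]. *)
have [h h0 hle] : exists2 h : R, 0 < h & [/\ 3 * h <= e1, 3 * h <= e2 & 3 * h <= e3].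
  exists (Num.min e1 (Num.min e2 e3) / 3).
    by rewrite divr_gt0 // !lt_min e10 e20 e30.
  rewrite mulrC divfK ?pnatr_eq0 //.
  by split; rewrite ?ge_min ?lexx ?orbT.
have near_u k l s t m : 0 <= s <= h -> 0 <= t <= h ->
    `|ucoord u m - ucoord (t *: ax k + (s *: ax l + u)) m| < 3 * h.
  exact: ucoord_square.
have hO k l s t : 0 <= s <= h -> 0 <= t <= h ->
    O (t *: ax k + (s *: ax l + u)).
  move=> sh th; apply: eO => m; apply: lt_le_trans (near_u _ _ _ _ _ sh th) _.
  by case: hle.
have inball k l s t e : 0 < s < h -> 0 < t < h -> 3 * h <= e ->
    ball u e (t *: ax k + (s *: ax l + u)).
  move=> /andP[s0 sh] /andP[t0 th] he; split.
    by apply: lt_le_trans he; rewrite mulr_gt0 ?ltr0n.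
  move=> z m; rewrite (ord1 z) -ball_normE /=.
  by apply: lt_le_trans (near_u _ _ _ _ _ _ _) he; rewrite !ltW.
have [s [t [sh th E1]]] :=
  second_difference f u i j h h0 (hO j i) (df i) (ddf i j).
have [s' [t' [sh' th' E2]]] :=
  second_difference f u j i h h0 (hO i j) (df j) (ddf j i).
(* Both sides, multiplied by h twice, are the same second difference of f. *)
have E3 : partial j (partial i f) (t *: ax j + (s *: ax i + u)) =
          partial i (partial j f) (t' *: ax i + (s' *: ax j + u)).
  apply: (mulIf (lt0r_neq0 h0)); apply: (mulIf (lt0r_neq0 h0)).
  apply: etrans (etrans (esym E1) _) E2.
  by rewrite (addrCA (h *: ax i) (h *: ax j)); congr (_ + _); rewrite addrAC.
have far (p q r : R) : `|p - q| = d * 2 -> `|q - r| < d -> `|p - r| < d -> False.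
  move=> pq qr pr; have := ler_distD r p q; rewrite pq (distrC r q) leNgt => /negP.
  by apply; rewrite mulr_natr mulr2n ltrD.
have [h1 h2 _] := hle.
have /= := He1 _ (inball i j _ _ _ sh' th' h1).
have /= := He2 _ (inball j i _ _ _ sh th h2).
by rewrite -!ball_normE /= E3; exact: far dE.
Qed.

End OpenSet.

(** * Differentiation rules and quadratic polynomials in one coordinate *)

Lemma is_derive_mul (R : realType) (f g : pt R -> R) (u v : pt R) (df dg : R) :
  is_derive u v f df -> is_derive u v g dg ->
  is_derive u v (fun w => f w * g w) (f u * dg + g u * df).
Proof. by move=> Hf Hg; exact: is_deriveM. Qed.

Lemma derivable_mul (R : realType) (f g : pt R -> R) (u v : pt R) :
  derivable f u v -> derivable g u v -> derivable (fun w => f w * g w) u v.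
Proof. exact: derivableM. Qed.

Lemma partialM (R : realType) (f g : pt R -> R) (u : pt R) (i : 'I_4) :
  derivable f u (ax i) -> derivable g u (ax i) ->
  partial i (fun w => f w * g w) u = f u * partial i g u + g u * partial i f u.
Proof.
move=> /derivableP df /derivableP dg.
by have [] := is_derive_mul _ _ _ _ _ _ _ df dg.
Qed.

Lemma partial_cst (R : realType) (c : R) (u : pt R) (i : 'I_4) :
  partial i (fun _ => c) u = 0.
Proof. exact: derive_cst. Qed.

Lemma partialZ (R : realType) (c : R) (f : pt R -> R) (u : pt R) (i : 'I_4) :
  derivable f u (ax i) -> partial i (fun w => c * f w) u = c * partial i f u.
Proof. exact: deriveZ. Qed.

Lemma partialD (R : realType) (f g : pt R -> R) (u : pt R) (i : 'I_4) :
  derivable f u (ax i) -> derivable g u (ax i) ->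
  partial i (fun w => f w + g w) u = partial i f u + partial i g u.
Proof. exact: deriveD. Qed.

Lemma partialB (R : realType) (f g : pt R -> R) (u : pt R) (i : 'I_4) :
  derivable f u (ax i) -> derivable g u (ax i) ->
  partial i (fun w => f w - g w) u = partial i f u - partial i g u.
Proof. exact: deriveB. Qed.

Lemma is_derive_ucoord (R : realType) (u : pt R) (i j : 'I_4) :
  is_derive u (ax j) (fun w => ucoord w i) ((i == j)%:R : R).
Proof.
(* The quotient is that of the linear map sending t to t times the Kronecker symbol, taken at 0 in
   direction 1. *)
have E : (fun h : R => h^-1 *: (((fun w => ucoord w i) \o shift u)
            (h *: ax j) - ucoord u i)) =
    (fun h : R => h^-1 *: ((( *:%R^~ ((i == j)%:R : R)) \o shift 0)
            (h *: (1 : R)) - (0 : R) *: (i == j)%:R)).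
  apply/funext => h /=; rewrite ucoord_line addrK addr0 scale0r subr0.
  by rewrite [h *: 1]mulr1; case: eqP => _; rewrite ?scaler0 // [h *: 1]mulr1.
have [D1 D2] : is_derive (0 : R) 1 ( *:%R^~ ((i == j)%:R : R)) (i == j)%:R.
  apply: DeriveDef; first exact/derivable1_diffP.
  by rewrite deriveE // diff_val scale1r.
by apply: DeriveDef; move: D1 D2; rewrite /derivable /derive E.
Qed.

(** This family is closed under every [partial j], so all iterated partial derivatives stay inside
    it; smoothness then only needs one continuity and one derivability statement. *)
Definition quadratic {R : realType} (p q r : R) (i : 'I_4) (u : pt R) : R :=
  p * ucoord u i ^+ 2 + q * ucoord u i + r.

Lemma is_derive_quadratic (R : realType) (p q r : R) (i j : 'I_4) (u : pt R) :
  is_derive u (ax j) (quadratic p q r i)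
    ((i == j)%:R * (2 * p * ucoord u i + q)).
Proof.
have dx := is_derive_ucoord R u i j.
have dc (c : R) : is_derive u (ax j) (cst c) 0 by exact: is_derive_cst.
have := is_derive_mul _ _ _ _ _ _ _ (dc p) (is_derive_mul _ _ _ _ _ _ _ dx dx).
move=> /is_deriveD /(_ (is_derive_mul _ _ _ _ _ _ _ (dc q) dx)).
move=> /is_deriveD /(_ (dc r)) H.
have E : quadratic p q r i = (fun w => cst p w * (ucoord w i * ucoord w i)) +
  (fun w => cst q w * ucoord w i) + cst r by apply/funext => w.
by rewrite E; apply: is_derive_eq H _; rewrite /=; ring.
Qed.

Lemma partial_quadratic (R : realType) (p q r : R) (i j : 'I_4) :
  partial j (quadratic p q r i) =
  quadratic 0 ((i == j)%:R * (2 * p)) ((i == j)%:R * q) i.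
Proof.
apply/funext => u; have [_] := is_derive_quadratic _ p q r i j u.
by rewrite /partial => ->; rewrite /quadratic; ring.
Qed.

Lemma continuous_quadratic (R : realType) (p q r : R) (i : 'I_4) :
  continuous (quadratic p q r i : pt R -> R).
Proof.
have cc : continuous (fun w : pt R => ucoord w i) by exact: coord_continuous.
move=> u; have {}cc := cc u.
have ck (c : R) : {for u, continuous (cst c : pt R -> R)} by exact: cst_continuous.
have E : quadratic p q r i = (fun w => cst p w * (ucoord w i * ucoord w i)) +
  (fun w => cst q w * ucoord w i) + cst r by apply/funext => w.
rewrite E; apply: continuousD; last exact: ck.
by apply: continuousD; apply: continuousM => //; apply: continuousM.
Qed.

Lemma iter_partial_rcons (R : realType) (l : seq 'I_4) (i : 'I_4) (f : pt R -> R) :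
  iter_partial (rcons l i) f = iter_partial l (partial i f).
Proof. by elim: l => //= j l ->. Qed.

Lemma iter_partial_quadratic (R : realType) (l : seq 'I_4) (i : 'I_4) (p q r : R) :
  exists p' q' r', iter_partial l (quadratic p q r i) = quadratic p' q' r' i.
Proof.
elim: l => [|j l [p' [q' [r' /= ->]]]]; first by exists p, q, r.
by rewrite partial_quadratic; do 3 eexists.
Qed.

(** * Calculus of smooth functions on O *)

Section Smooth.
Context {R : realType} {O : set (pt R)}.
Hypothesis oO : open O.
Implicit Types (f g : pt R -> R) (u v : pt R) (i j : 'I_4).

Lemma smooth_derivable f u i : smooth_on O f -> O u -> derivable f u (ax i).
Proof. by move=> sf Ou; have [_] := sf [::] u Ou. Qed.

Lemma smooth_partial f i : smooth_on O f -> smooth_on O (partial i f).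
Proof. by move=> sf l u Ou; rewrite -iter_partial_rcons; exact: sf. Qed.

Lemma smooth_quadratic (p q r : R) i : smooth_on O (quadratic p q r i).
Proof.
move=> l u _; have [p' [q' [r' ->]]] := iter_partial_quadratic _ l i p q r.
split; first exact: continuous_quadratic.
by move=> j; have [] := is_derive_quadratic _ p' q' r' i j u.
Qed.

(** On O, iterated partial derivatives commute with subtraction, by induction on the list of
    directions; continuity and derivability carry over from the difference. *)
Lemma smoothB f g : smooth_on O f -> smooth_on O g ->
  smooth_on O (fun u => f u - g u).
Proof.
move=> sf sg l.
have E u : O u -> iter_partial l f u - iter_partial l g u =
    iter_partial l (fun u => f u - g u) u.
  elim: l u => [//|i l IH] u Ou /=.
  rewrite -(near_partial oO i _ _ _ Ou IH) partialB //.
    by have [_] := sf l u Ou.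
  by have [_] := sg l u Ou.
move=> u Ou; have [cf df] := sf l u Ou; have [cg dg] := sg l u Ou; split.
  by apply: (near_continuous oO _ _ _ Ou E); exact: continuousB.
by move=> i; apply: (near_derivable oO _ _ _ _ Ou E); exact: derivableB.
Qed.

Lemma smooth_partialC f u i j : smooth_on O f -> O u ->
  partial i (partial j f) u = partial j (partial i f) u.
Proof.
move=> sf Ou; apply: (partialC oO) => //.
- by move=> k v Ov; exact: smooth_derivable.
- by move=> k l v Ov; apply: smooth_derivable => //; exact: smooth_partial.
- by have [] := sf [:: i; j] u Ou.
- by have [] := sf [:: j; i] u Ou.
Qed.

(** After the two derivatives are exchanged, the inner one vanishes on all of O. *)
Lemma partial_partial0 f u i j : smooth_on O f -> O u ->
  (forall v, O v -> partial i f v = 0) -> partial i (partial j f) u = 0.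
Proof.
move=> sf Ou f0; rewrite smooth_partialC // (near_partial oO j _ _ _ Ou f0).
exact: partial_cst.
Qed.

End Smooth.

(** * Pointwise algebra of the Walker curvature *)

Definition i2 : 'I_4 := @Ordinal 4 2 isT.
Definition i3 : 'I_4 := @Ordinal 4 3 isT.

Lemma ord4P (P : 'I_4 -> Prop) : P i0 -> P i1 -> P i2 -> P i3 -> forall i, P i.
Proof.
move=> P0 P1 P2 P3 [[|[|[|[|//]]]] H].
- by rewrite (_ : Ordinal H = i0) //; exact: val_inj.
- by rewrite (_ : Ordinal H = i1) //; exact: val_inj.
- by rewrite (_ : Ordinal H = i2) //; exact: val_inj.
- by rewrite (_ : Ordinal H = i3) //; exact: val_inj.
Qed.

Lemma sum_ord4 (V : nmodType) (F : 'I_4 -> V) :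
  \sum_(i < 4) F i = F i0 + F i1 + F i2 + F i3.
Proof.
rewrite !big_ord_recr big_ord0 /= add0r.
by do 3?[congr (_ + _)]; congr F; exact: val_inj.
Qed.

Section WalkerSymbols.
Context {F : numFieldType}.
Variables (a b : F) (da db : 'I_4 -> F) (dda ddb : 'I_4 -> 'I_4 -> F).

(** The values of a, b and their derivatives at a point become free scalars, so that curvature
    identities turn into field identities. Derivatives along the last two axes, being zero, are left
    out. *)
Definition walker_christoffel (k i j : 'I_4) : F :=
  match val k, val i, val j with
  | 0%N, 0%N, 2%N | 0%N, 2%N, 0%N => 2^-1 * da i0
  | 0%N, 1%N, 2%N | 0%N, 2%N, 1%N => 2^-1 * da i1
  | 0%N, 2%N, 2%N => 2^-1 * (a * da i0)
  | 0%N, 3%N, 3%N => 2^-1 * (a * db i0)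
  | 1%N, 0%N, 3%N | 1%N, 3%N, 0%N => 2^-1 * db i0
  | 1%N, 1%N, 3%N | 1%N, 3%N, 1%N => 2^-1 * db i1
  | 1%N, 2%N, 2%N => 2^-1 * (b * da i1)
  | 1%N, 3%N, 3%N => 2^-1 * (b * db i1)
  | 2%N, 2%N, 2%N => - 2^-1 * da i0
  | 2%N, 3%N, 3%N => - 2^-1 * db i0
  | 3%N, 2%N, 2%N => - 2^-1 * da i1
  | 3%N, 3%N, 3%N => - 2^-1 * db i1
  | _, _, _ => 0
  end.

(* [dda m n] and [ddb m n] stand for the derivative in direction [m] of the
   [n]-th partial derivative. *)
Definition walker_dchristoffel (m k i j : 'I_4) : F :=
  match val k, val i, val j with
  | 0%N, 0%N, 2%N | 0%N, 2%N, 0%N => 2^-1 * dda m i0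
  | 0%N, 1%N, 2%N | 0%N, 2%N, 1%N => 2^-1 * dda m i1
  | 0%N, 2%N, 2%N => 2^-1 * (a * dda m i0 + da i0 * da m)
  | 0%N, 3%N, 3%N => 2^-1 * (a * ddb m i0 + db i0 * da m)
  | 1%N, 0%N, 3%N | 1%N, 3%N, 0%N => 2^-1 * ddb m i0
  | 1%N, 1%N, 3%N | 1%N, 3%N, 1%N => 2^-1 * ddb m i1
  | 1%N, 2%N, 2%N => 2^-1 * (b * dda m i1 + da i1 * db m)
  | 1%N, 3%N, 3%N => 2^-1 * (b * ddb m i1 + db i1 * db m)
  | 2%N, 2%N, 2%N => - 2^-1 * dda m i0
  | 2%N, 3%N, 3%N => - 2^-1 * ddb m i0
  | 3%N, 2%N, 2%N => - 2^-1 * dda m i1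
  | 3%N, 3%N, 3%N => - 2^-1 * ddb m i1
  | _, _, _ => 0
  end.

Definition walker_ricci (i j : 'I_4) : F :=
  match val i, val j with
  | 0%N, 2%N | 2%N, 0%N => 2^-1 * dda i0 i0
  | 1%N, 2%N | 2%N, 1%N => 2^-1 * dda i0 i1
  | 0%N, 3%N | 3%N, 0%N => 2^-1 * ddb i1 i0
  | 1%N, 3%N | 3%N, 1%N => 2^-1 * ddb i1 i1
  | 2%N, 2%N => 2^-1 * (a * dda i0 i0 + (b * dda i1 i1 + da i1 * db i1))
  | 3%N, 3%N => 2^-1 * (b * ddb i1 i1 + (a * ddb i0 i0 + db i0 * da i0))
  | 2%N, 3%N | 3%N, 2%N => - 2^-1 * (da i1 * db i0)
  | _, _ => 0
  end.

(** A check of the 16 components; the hypotheses record that a and b do not vary along the last two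
    axes and that mixed derivatives commute. *)
Lemma walker_ricciE i j :
  da i2 = 0 -> da i3 = 0 -> db i2 = 0 -> db i3 = 0 ->
  (forall n, dda i2 n = 0) -> (forall n, dda i3 n = 0) ->
  (forall n, ddb i2 n = 0) -> (forall n, ddb i3 n = 0) ->
  dda i1 i0 = dda i0 i1 -> ddb i1 i0 = ddb i0 i1 ->
  \sum_(k < 4) (walker_dchristoffel k k i j - walker_dchristoffel j k i k)
  + \sum_(k < 4) \sum_(l < 4)
      (walker_christoffel k k l * walker_christoffel l i j
       - walker_christoffel k j l * walker_christoffel l i k)
  = walker_ricci i j.
Proof.
move=> a2 a3 b2 b3 da2 da3 db2 db3 ca cb; rewrite !sum_ord4.
by elim/ord4P: i; elim/ord4P: j;
  rewrite /walker_christoffel /walker_dchristoffel /walker_ricci /=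
    ?(a2, a3, b2, b3, da2, da3, db2, db3, ca, cb); field.
Qed.

(** Once a_11 = b_22 = 2 lambda, the terms a a_11 / 2 and b b_22 / 2 of rho_33 and rho_44 already
    equal lambda a and lambda b, so the remaining terms must vanish. *)
Lemma walker_ricciP (lambda : F) :
  (forall i j, walker_ricci i j = lambda *
     match val i, val j with
     | 0%N, 2%N | 2%N, 0%N | 1%N, 3%N | 3%N, 1%N => 1
     | 2%N, 2%N => a
     | 3%N, 3%N => b
     | _, _ => 0
     end) <->
  [/\ dda i0 i0 = 2 * lambda, ddb i1 i1 = 2 * lambda,
      dda i0 i1 = 0 & ddb i1 i0 = 0] /\
  [/\ da i1 * db i0 = 0,
      a * ddb i0 i0 + db i0 * da i0 = 0 &
      b * dda i1 i1 + da i1 * db i1 = 0].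
Proof.
have half (x y : F) : 2^-1 * x = y -> x = 2 * y.
  by move=> <-; rewrite mulrA divff ?mul1r ?pnatr_eq0.
have halfK (x : F) : 2^-1 * (2 * x) = x by rewrite mulKf // pnatr_eq0.
split=> [E|[[e02 e13 e12 e03] [e23 e33 e22]]].
  move: (E i0 i2) (E i1 i3) (E i1 i2) (E i0 i3) (E i2 i3) (E i3 i3) (E i2 i2).
  rewrite /walker_ricci /= !(mulr0, mulr1) mulNr.
  move=> /half -> /half -> /half -> /half -> /eqP.
  rewrite oppr_eq0 !mulr0 => /eqP/half -> /half e33 /half e22; rewrite mulr0.
  split; split => //.
    by apply: (addrI (b * (2 * lambda))); rewrite e33; ring.
  by apply: (addrI (a * (2 * lambda))); rewrite e22; ring.
elim/ord4P; elim/ord4P; rewrite /walker_ricci /=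
  ?(e02, e13, e12, e03, e23, e33, e22) ?(addr0, mulr0, mulr1) ?halfK //.
- by rewrite mulrCA halfK mulrC.
- by rewrite mulrCA halfK mulrC.
Qed.

End WalkerSymbols.

(** * Christoffel symbols and Ricci tensor of the Walker metric *)

Section Walker.
#[local] Opaque partial.
Context {R : realType} {O : set (pt R)} {a b : pt R -> R}.
Hypothesis oO : open O.
Hypotheses (sa : smooth_on O a) (sb : smooth_on O b).
Hypotheses (ha : depends_only_on O [:: i0; i1] a).
Hypotheses (hb : depends_only_on O [:: i0; i1] b).

(** In 2 by 2 blocks the metric is [0, I; I, S] with S = diag(a, b), and its inverse is
    [-S, I; I, 0]. *)
Definition walker_inv (u : pt R) : 'M[R]_4 :=
  \matrix_(i < 4, j < 4)
    match val i, val j with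
    | 0%N, 0%N => - a u | 1%N, 1%N => - b u
    | 0%N, 2%N | 2%N, 0%N | 1%N, 3%N | 3%N, 1%N => 1
    | _, _ => 0
    end.

Lemma invmx_walker u : invmx (walker a b u) = walker_inv u.
Proof.
have E : walker_inv u *m walker a b u = 1%:M.
  apply/matrixP; apply: ord4P; apply: ord4P;
    by rewrite !mxE sum_ord4 !mxE /=; ring.
have [_ U] := mulmx1_unit E.
by rewrite -[LHS]mul1mx -E mulmxK.
Qed.

Lemma walkerE u i j : walker a b u i j =
  match val i, val j with
  | 0%N, 2%N | 2%N, 0%N | 1%N, 3%N | 3%N, 1%N => 1
  | 2%N, 2%N => a u
  | 3%N, 3%N => b u
  | _, _ => 0
  end.
Proof. by rewrite mxE; elim/ord4P: i; elim/ord4P: j. Qed.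

Lemma partial_walker i j l u :
  partial i (fun v => walker a b v j l) u =
  match val j, val l with
  | 2%N, 2%N => partial i a u
  | 3%N, 3%N => partial i b u
  | _, _ => 0
  end.
Proof.
have E : (fun v => walker a b v j l) =
    match val j, val l with
    | 2%N, 2%N => a | 3%N, 3%N => b
    | 0%N, 2%N | 2%N, 0%N | 1%N, 3%N | 3%N, 1%N => fun _ => 1
    | _, _ => fun _ => 0
    end.
  by apply/funext => v; rewrite walkerE; elim/ord4P: j; elim/ord4P: l.
by rewrite E {E}; elim/ord4P: j; elim/ord4P: l => //=; exact: partial_cst.
Qed.

Let da u m := partial m a u.
Let db u m := partial m b u.
Let dda u m n := partial m (partial n a) u.
Let ddb u m n := partial m (partial n b) u.

Lemma christoffel_walker k i j u : O u ->
  christoffel (walker a b) k i j u =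
  walker_christoffel (a u) (b u) (da u) (db u) k i j.
Proof.
move=> Ou; rewrite /christoffel sum_ord4 invmx_walker !mxE !partial_walker.
have := ha u Ou i2 isT; have := ha u Ou i3 isT.
have := hb u Ou i2 isT; have := hb u Ou i3 isT.
have Ea m : partial m a u = da u m by [].
have Eb m : partial m b u = db u m by [].
rewrite !Ea !Eb.
(* With values and gradients generalised to free scalars, each of the 64 cases is a ring
   identity. *)
move: (a u) (b u) (da u) (db u) {Ea Eb} => x y dx dy y3 y2 x3 x2.
by elim/ord4P: k; elim/ord4P: i; elim/ord4P: j;
  rewrite /walker_christoffel /= ?(x2, x3, y2, y3); ring.
Qed.

Lemma partial_christoffel_walker m k i j u : O u ->
  partial m (christoffel (walker a b) k i j) u =
  walker_dchristoffel (a u) (b u) (da u) (db u) (dda u) (ddb u) m k i j.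
Proof.
move=> Ou; rewrite (near_partial oO m _ _ _ Ou (christoffel_walker k i j)).
(* A symbol is 0, a constant times a first derivative (rule [Z]), or a constant times a function
   times a first derivative (rule [M]). *)
have Z c n f : smooth_on O f ->
    partial m (fun v => c * partial n f v) u = c * partial m (partial n f) u.
  by move=> sf; apply: partialZ; exact: smooth_derivable (smooth_partial _ n sf) Ou.
have M c n f g : smooth_on O f -> smooth_on O g ->
    partial m (fun v => c * (f v * partial n g v)) u =
    c * (f u * partial m (partial n g) u + partial n g u * partial m f u).
  move=> sf sg; have df : derivable f u (ax m) := smooth_derivable _ _ _ sf Ou.
  have dg : derivable (partial n g) u (ax m).
    exact: smooth_derivable (smooth_partial _ n sg) Ou.
  rewrite -(partialM _ f) //.
  by apply: (partialZ _ c (fun v => f v * partial n g v)); exact: derivable_mul.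
by elim/ord4P: k; elim/ord4P: i; elim/ord4P: j;
  rewrite /walker_christoffel /walker_dchristoffel /=;
  match goal with
  | |- _ = 0 => exact: partial_cst
  | |- _ = _ * (_ + _) => exact: M
  | |- _ => exact: Z
  end.
Qed.

Lemma ricci_walker i j u : O u ->
  ricci (walker a b) i j u =
  walker_ricci (a u) (b u) (da u) (db u) (dda u) (ddb u) i j.
Proof.
move=> Ou.
have ha2 k n : k \notin [:: i0; i1] -> dda u k n = 0.
  by move=> kn; apply: (partial_partial0 oO) => // v Ov; exact: ha.
have hb2 k n : k \notin [:: i0; i1] -> ddb u k n = 0.
  by move=> kn; apply: (partial_partial0 oO) => // v Ov; exact: hb.
have ca : dda u i1 i0 = dda u i0 i1 by exact: (smooth_partialC oO).
have cb : ddb u i1 i0 = ddb u i0 i1 by exact: (smooth_partialC oO).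
apply: etrans (walker_ricciE _ _ _ _ _ _ i j (ha u Ou i2 isT)
  (ha u Ou i3 isT) (hb u Ou i2 isT) (hb u Ou i3 isT)
  (fun n => ha2 i2 n isT) (fun n => ha2 i3 n isT)
  (fun n => hb2 i2 n isT) (fun n => hb2 i3 n isT) ca cb).
congr (_ + _); apply: eq_bigr => k _.
  by congr (_ - _); exact: partial_christoffel_walker.
by apply: eq_bigr => l _; congr (_ * _ - _ * _); exact: christoffel_walker.
Qed.

End Walker.

(** * The Einstein equation as a differential system, and its integration *)

Section Einstein.
Context {R : realType} {O : set (pt R)}.
Hypothesis oO : open O.
Implicit Types (f g B D : pt R -> R) (u v : pt R) (i j : 'I_4).
#[local] Opaque partial.

Lemma einstein_walkerP a b :
  smooth_on O a -> smooth_on O b ->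
  depends_only_on O [:: i0; i1] a -> depends_only_on O [:: i0; i1] b ->
  einstein_on O (walker a b) <->
  exists lambda : R, forall u, O u ->
    [/\ partial i0 (partial i0 a) u = 2 * lambda,
        partial i1 (partial i1 b) u = 2 * lambda,
        partial i0 (partial i1 a) u = 0 & partial i1 (partial i0 b) u = 0] /\
    [/\ partial i1 a u * partial i0 b u = 0,
        a u * partial i0 (partial i0 b) u + partial i0 b u * partial i0 a u = 0 &
        b u * partial i1 (partial i1 a) u + partial i1 a u * partial i1 b u = 0].
Proof.
move=> sa sb ha hb.
have rE u i j Ou := ricci_walker oO sa sb ha hb i j u Ou.
have rP u lambda := walker_ricciP (a u) (b u)
  (fun m => partial m a u) (fun m => partial m b u)
  (fun m n => partial m (partial n a) u) (fun m n => partial m (partial n b) u)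
  lambda.
split=> -[lambda E]; exists lambda => u Ou.
  by apply: (rP u lambda).1 => i j; rewrite -walkerE -E // rE.
by move=> i j; rewrite rE // walkerE; exact: (rP u lambda).2 (E u Ou) i j.
Qed.

(** The difference of [partial i f] and 2 K u_i has zero gradient on the connected set O; A is its
    constant value. *)
Lemma axis_affine f i (K : R) : connected O -> smooth_on O f ->
  (forall u, O u -> partial i (partial i f) u = 2 * K) ->
  (forall u j, O u -> j != i -> partial j (partial i f) u = 0) ->
  exists A, forall u, O u -> partial i f u = 2 * K * ucoord u i + A.
Proof.
move=> cO sf fii fij.
pose q := quadratic 0 (2 * K) 0 i.
have [v j Ov|A HA] := @partial0_constant _ _ oO (fun u => partial i f u - q u) cO.
  have dq : derivable q v (ax j) by have [] := is_derive_quadratic _ 0 (2 * K) 0 i j v.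
  have df : derivable (partial i f) v (ax j).
    exact: smooth_derivable (smooth_partial _ i sf) Ov.
  split.
    exact: (smooth_derivable _ _ j (smoothB oO _ _ (smooth_partial _ i sf)
      (smooth_quadratic 0 (2 * K) 0 i)) Ov).
  apply: etrans (partialB _ (partial i f) q v j df dq) _.
  rewrite partial_quadratic /quadratic.
  have [<-|ij] := eqVneq i j; last by rewrite fij 1?eq_sym //=; ring.
  by rewrite fii //=; ring.
exists A => u Ou; rewrite -(HA u Ou) /q /quadratic; ring.
Qed.

Lemma partial_sub_quadratic f i j (p q : R) u : smooth_on O f -> O u ->
  partial j (fun v => f v - quadratic p q 0 i v) u =
  partial j f u - (i == j)%:R * (2 * p * ucoord u i + q).
Proof.
move=> sf Ou; have [dq dqE] := is_derive_quadratic _ p q 0 i j u.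
have df : derivable f u (ax j) := smooth_derivable _ _ _ sf Ou.
apply: etrans (partialB _ f (quadratic p q 0 i) u j df dq) _.
by congr (_ - _); exact: dqE.
Qed.

(** Links the last two equations of the theorem to a b_11 + b_1 a_1 and its counterpart with a and b
    exchanged: on O the differentiated product is f g_i, and the product rule applies. *)
Lemma partial_decomposed f g B D i (K A : R) u :
  smooth_on O f -> smooth_on O g -> O u ->
  (forall v, O v -> f v = K * ucoord v i ^+ 2 + A * ucoord v i + B v) ->
  (forall v, O v -> partial i D v = partial i g v) ->
  partial i (fun v => partial i D v *
    (ucoord v i ^+ 2 * K + ucoord v i * A + B v)) u =
  f u * partial i (partial i g) u + partial i g u * partial i f u.
Proof.
move=> sf sg Ou fE DE.
have E v : O v -> partial i D v * (ucoord v i ^+ 2 * K + ucoord v i * A + B v) =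
    f v * partial i g v.
  by move=> Ov; rewrite DE // fE //; ring.
apply: etrans (near_partial oO i _ _ _ Ou E) _.
apply: partialM; first exact: smooth_derivable Ou.
exact: smooth_derivable (smooth_partial _ i sg) Ou.
Qed.

Lemma partial_quadraticD f B i j (p q : R) u :
  smooth_on O B -> O u ->
  (forall v, O v -> f v = p * ucoord v i ^+ 2 + q * ucoord v i + B v) ->
  partial j f u = (i == j)%:R * (2 * p * ucoord u i + q) + partial j B u.
Proof.
move=> sB Ou fE; have [dq dqE] := is_derive_quadratic _ p q 0 i j u.
have E v : O v -> f v = quadratic p q 0 i v + B v.
  by move=> Ov; rewrite fE // /quadratic addr0.
apply: etrans (near_partial oO j _ _ _ Ou E) _.
apply: etrans (partialD _ (quadratic p q 0 i) B u j dq _) _.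
  exact: smooth_derivable Ou.
by congr (_ + _); exact: dqE.
Qed.

Lemma partial2_quadraticD f B i (p q : R) u :
  smooth_on O B -> O u -> (forall v, O v -> partial i B v = 0) ->
  (forall v, O v -> f v = p * ucoord v i ^+ 2 + q * ucoord v i + B v) ->
  partial i (partial i f) u = 2 * p.
Proof.
move=> sB Ou Bi fE.
have E v : O v -> partial i f v = quadratic 0 (2 * p) q i v.
  move=> Ov; rewrite (partial_quadraticD _ _ _ i _ _ _ sB Ov fE) Bi // eqxx /=.
  by rewrite /quadratic; ring.
apply: etrans (near_partial oO i _ _ _ Ou E) _.
by rewrite partial_quadratic eqxx /quadratic /=; ring.
Qed.

End Einstein.

Theorem theorem3p2 (R : realType) (O : set (pt R)) (a b : pt R -> R) :
  open O -> connected O ->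
  smooth_on O a -> smooth_on O b ->
  depends_only_on O [:: i0; i1] a -> depends_only_on O [:: i0; i1] b ->
  einstein_on O (walker a b) <->
  exists (K A C : R) (B D : pt R -> R),
    smooth_on O B /\ smooth_on O D /\
    depends_only_on O [:: i1] B /\ depends_only_on O [:: i0] D /\
    forall u, O u ->
      a u = K * ucoord u i0 ^+ 2 + A * ucoord u i0 + B u /\
      b u = K * ucoord u i1 ^+ 2 + C * ucoord u i1 + D u /\
      partial i1 B u * partial i0 D u = 0 /\
      partial i0 (fun v => partial i0 D v *
                    (ucoord v i0 ^+ 2 * K + ucoord v i0 * A + B v)) u = 0 /\
      partial i1 (fun v => partial i1 B v *
                    (ucoord v i1 ^+ 2 * K + ucoord v i1 * C + D v)) u = 0.
Proof.
move=> oO cO sa sb ha hb; apply: iff_trans (einstein_walkerP oO _ _ sa sb ha hb) _.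
split.
(* The Einstein constant itself serves as K, because a_11 = b_22 = 2 lambda. *)
- move=> [K E].
  have far f i (j : 'I_4) u :
      smooth_on O f -> depends_only_on O [:: i0; i1] f -> O u ->
      j \notin [:: i0; i1] -> partial j (partial i f) u = 0.
    by move=> sf hf Ou jn; apply: (partial_partial0 oO) => // v Ov; exact: hf.
  have [||A HA] := axis_affine oO a i0 K cO sa.
  + by move=> u Ou; have [[-> _ _ _] _] := E u Ou.
  + move=> u j Ou; elim/ord4P: j => // _; [|exact: far|exact: far].
    (* The system gives the mixed derivative in the other order. *)
    rewrite (smooth_partialC oO) //; by have [[_ _ -> _] _] := E u Ou.
  have [||C HC] := axis_affine oO b i1 K cO sb.
  + by move=> u Ou; have [[_ -> _ _] _] := E u Ou.
  + move=> u j Ou; elim/ord4P: j => // _; [|exact: far|exact: far].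
    rewrite (smooth_partialC oO) //; by have [[_ _ _ ->] _] := E u Ou.
  pose B v := a v - quadratic K A 0 i0 v.
  pose D v := b v - quadratic K C 0 i1 v.
  have BE j u : O u ->
      partial j B u = partial j a u - (i0 == j)%:R * (2 * K * ucoord u i0 + A).
    by move=> Ou; exact: (partial_sub_quadratic _ _ _ _ _ _ sa Ou).
  have DE j u : O u ->
      partial j D u = partial j b u - (i1 == j)%:R * (2 * K * ucoord u i1 + C).
    by move=> Ou; exact: (partial_sub_quadratic _ _ _ _ _ _ sb Ou).
  have B1 v : O v -> partial i1 B v = partial i1 a v.
    by move=> Ov; rewrite BE // mul0r subr0.
  have D0 v : O v -> partial i0 D v = partial i0 b v.
    by move=> Ov; rewrite DE // mul0r subr0.
  have aE v : O v -> a v = K * ucoord v i0 ^+ 2 + A * ucoord v i0 + B v.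
    by move=> _; rewrite /B /quadratic addr0 addrC subrK.
  have bE v : O v -> b v = K * ucoord v i1 ^+ 2 + C * ucoord v i1 + D v.
    by move=> _; rewrite /D /quadratic addr0 addrC subrK.
  exists K, A, C, B, D.
  split; first exact: (smoothB oO _ _ sa (smooth_quadratic K A 0 i0)).
  split; first exact: (smoothB oO _ _ sb (smooth_quadratic K C 0 i1)).
  split.
    (* Along u_1 the choice of A cancels a_1; along u_3 and u_4 the derivatives of B are those of
       a. *)
    move=> u Ou j; rewrite BE //; elim/ord4P: j => // _.
    + by rewrite HA // mul1r subrr.
    + by rewrite mul0r subr0 ha.
    + by rewrite mul0r subr0 ha.
  split.
    move=> u Ou j; rewrite DE //; elim/ord4P: j => // _.
    + by rewrite HC // mul1r subrr.
    + by rewrite mul0r subr0 hb.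
    + by rewrite mul0r subr0 hb.
  move=> u Ou; have [_ [e1 e2 e3]] := E u Ou.
  split; first exact: aE.
  split; first exact: bE.
  split; first by rewrite B1 // D0.
  split; first exact: etrans (partial_decomposed oO _ _ _ _ _ _ _ _ sa sb Ou aE D0) e2.
  exact: etrans (partial_decomposed oO _ _ _ _ _ _ _ _ sb sa Ou bE B1) e3.
(* Conversely, K is the Einstein constant, and the system is recovered from B_1 = D_2 = 0, B_2 = a_2
   and D_1 = b_1. *)
- move=> [K [A [C [B [D [sB [sD [hB [hD E]]]]]]]]]; exists K.
  have aE v : O v -> a v = K * ucoord v i0 ^+ 2 + A * ucoord v i0 + B v.
    by move=> Ov; have [] := E v Ov.
  have bE v : O v -> b v = K * ucoord v i1 ^+ 2 + C * ucoord v i1 + D v.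
    by move=> Ov; have [_ []] := E v Ov.
  have B0 v : O v -> partial i0 B v = 0 by move=> Ov; exact: hB.
  have D1 v : O v -> partial i1 D v = 0 by move=> Ov; exact: hD.
  have a1 v : O v -> partial i1 B v = partial i1 a v.
    by move=> Ov; rewrite (partial_quadraticD oO _ _ _ i1 _ _ _ sB Ov aE) mul0r add0r.
  have b0 v : O v -> partial i0 D v = partial i0 b v.
    by move=> Ov; rewrite (partial_quadraticD oO _ _ _ i0 _ _ _ sD Ov bE) mul0r add0r.
  move=> u Ou; have [_ [_ [e1 [e2 e3]]]] := E u Ou; split; split.
  + exact: (partial2_quadraticD oO _ _ _ _ _ _ sB Ou B0 aE).
  + exact: (partial2_quadraticD oO _ _ _ _ _ _ sD Ou D1 bE).
  (* Here a_2 = B_2 on O, and its u_1-derivative vanishes because B_1 does. *)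
  + rewrite -(near_partial oO i0 _ _ _ Ou a1); exact: (partial_partial0 oO).
  + rewrite -(near_partial oO i1 _ _ _ Ou b0); exact: (partial_partial0 oO).
  + by rewrite -a1 // -b0.
  + exact: etrans (esym (partial_decomposed oO _ _ _ _ _ _ _ _ sa sb Ou aE b0)) e2.
  + exact: etrans (esym (partial_decomposed oO _ _ _ _ _ _ _ _ sb sa Ou bE a1)) e3.
Qed.
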